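(* Let $\theta\ge0$. If $1<p_2\le p_1<\infty$ and $1<q_2\le q_1<\infty$, then $$W(L^{p_1),\theta},L^{q_1),\theta})\subset W(L^{p_2),\theta},L^{q_2),\theta}).$$
   Context: $\Omega$ is a locally compact Hausdorff space with a finite Borel measure $\mu$, and $Q\subset\Omega$ is a fixed compact subset with nonempty interior. To make sense of translates, $\Omega$ is a locally compact Borel subset (possibly all) of a locally compact Hausdorff abelian group $G$, written additively; for $x\in\Omega$, $Q+x=\{t+x:t\in Q\}$ and $\chi_{Q+x}$ is the characteristic function of $(Q+x)\cap\Omega$ on $\Omega$. Functions are identified when equal $\mu$-a.e. Generalized grand Lebesgue space: for $1<p<\infty$, $\theta\ge0$, $L^{p),\theta}=L^{p),\theta}(\mu)$ is the space of measurable $f$ with $\|f\|_{p),\theta}=\sup_{0<\varepsilon\le p-1}\varepsilon^{\frac{\theta}{p-\varepsilon}}\left(\int_\Omega|f|^{p-\varepsilon}d\mu\right)^{\frac1{p-\varepsilon}}<\infty$. $(L^{p),\theta})_{loc}$ is the space of measurable $f$ with $f\chi_K\in L^{p),\theta}$ for every compact $K\subset\Omega$. Grand Wiener amalgam space: for $1<p,q<\infty$, $W(L^{p),\theta},L^{q),\theta})$ is the space of $f\in(L^{p),\theta})_{loc}$ such that $F_f^{p),\theta}(x)=\|f\chi_{Q+x}\|_{p),\theta}$ lies in $L^{q),\theta}$, with norm $\|F_f^{p),\theta}\|_{q),\theta}$.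
   Formalization: The finite Borel measure μ is additionally assumed regular (inner regular by compact sets) on Ω; for non-regular μ the function F_f for p_2 can fail to be measurable although that for p_1 is, and the inclusion fails. *)

(* Defs.v *)
(* MathComp / MathComp-Analysis *)
From HB Require Import structures.
From mathcomp Require Import all_boot all_order all_algebra.
From mathcomp Require Import all_classical all_reals all_analysis.
From mathcomp Require Import measurable_realfun.

Set Implicit Arguments.
Unset Strict Implicit.
Unset Printing Implicit Defensive.

Import Order.TTheory GRing.Theory Num.Theory.
Import numFieldNormedType.Exports.

Local Open Scope classical_set_scope.
Local Open Scope ring_scope.

(* [g_sigma_algebraType] requires a distinguished point, which
   [topologicalZmodType] does not provide; the alias only adds the point 0. *)
Definition pointed_group (G : topologicalZmodType) : Type := G.
HB.instance Definition _ (G : topologicalZmodType) :=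
  Choice.on (pointed_group G).
HB.instance Definition _ (G : topologicalZmodType) :=
  isPointed.Build (pointed_group G) (0 : G).

Notation borel G :=
  (g_sigma_algebraType (@open G : set (set (pointed_group G)))).

(* Objects living on a subset Omega of the group G are represented in G: a
   Borel measure on Omega is (the trace on Omega of) a Borel measure mu on G,
   and a function on Omega is a function on G of which only the values on
   Omega are used. Functions take extended real values because the control
   function below may be infinite at some points. *)
Section grand_spaces.
Context {R : realType} {G : topologicalZmodType}.
Variables (mu : {measure set (borel G) -> \bar R}) (Omega : set (borel G)).

(* A finite Borel measure on a locally compact Hausdorff space is understood to
   be regular (Radon): without regularity the control function of a measurable
   function need not be measurable. Outer regularity follows by complements
   when mu Omega is finite. *)
Definition regular_on : Prop :=
  forall A : set (borel G), measurable A -> A `<=` Omega ->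
    mu A = ereal_sup [set mu K | K in
                       [set K | compact (K : set G) /\ K `<=` A]].

Variable theta : R.

Definition grand_norm (p : R) (f : borel G -> \bar R) : \bar R :=
  ereal_sup [set ((eps `^ (theta / (p - eps)))%:E *
                  (\int[mu]_(x in Omega) `|f x| `^ (p - eps)) `^
                    (p - eps)^-1)%E
            | eps in [set eps : R | 0 < eps <= p - 1]].

Definition grand_lebesgue (p : R) : set (borel G -> \bar R) :=
  [set f : borel G -> \bar R | measurable_fun Omega f /\ (grand_norm p f < +oo)%E].

Definition grand_lebesgue_loc (p : R) : set (borel G -> \bar R) :=
  [set f : borel G -> \bar R | measurable_fun Omega f /\
     forall K : set (borel G), compact (K : set G) -> K `<=` Omega ->
       grand_lebesgue p (f \_ K)].

Variable Q : set (borel G).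

Definition translate (x : G) : set (borel G) :=
  [set (t : G) + x | t in Q].

(* The intersection of Q + x with Omega is taken implicitly, since
   [grand_norm] integrates over Omega. *)
Definition control_fun (p : R) (f : borel G -> \bar R) : borel G -> \bar R :=
  fun x => grand_norm p (f \_ (translate x)).

Definition grand_amalgam (p q : R) : set (borel G -> \bar R) :=
  [set f : borel G -> \bar R | grand_lebesgue_loc p f /\ grand_lebesgue q (control_fun p f)].

End grand_spaces.

(* Main.v *)
Require Import Defs.
From mathcomp Require Import all_boot all_order all_algebra.
From mathcomp Require Import all_classical all_reals all_analysis.
From mathcomp Require Import measurable_realfun.
From mathcomp Require Import lra.

Set Implicit Arguments.
Unset Strict Implicit.
Unset Printing Implicit Defensive.

Import Order.TTheory GRing.Theory Num.Theory.
Import numFieldNormedType.Exports.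

Local Open Scope classical_set_scope.
Local Open Scope ring_scope.

(** The inclusion has a quantitative half and a measurability half.

    Quantitatively, [grand_norm_le_exponent] says that on a space of finite
    mass a larger exponent gives a larger grand norm, up to a constant that
    does not depend on the function: the terms of the two suprema with the same
    [eps] are compared by the power mean inequality [Lmean_le], and the weights
    [eps `^ (theta / (p - eps))] by [grand_weight_le]. Applied to the functions
    [f \_ K] this gives the local part of the claim; applied to
    [f \_ (translate Q x)] it bounds the control function for [p2] by a constant
    multiple of the one for [p1], uniformly in [x], and a last application, to
    the control function itself, lowers [q1] to [q2].

    That last application needs the control function for [p2] to be measurable,
    which is where the regularity of the measure enters. For a Borel subset [A]
    of [Omega], the map from [x] to the mass of [A `&` translate Q x] is upper
    semicontinuous ([measurable_fun_mu_translate]): a compact set that nearly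
    exhausts [A `\` translate Q x0] stays disjoint from [translate Q x] for [x]
    near [x0]. These masses form a kernel, so integrals of nonnegative functions
    over [translate Q x] are measurable in [x] as well
    ([measurable_fun_integral_translate]). Finally the uncountable supremum over
    [eps] in the grand norm may be restricted to rational [eps]
    ([grand_norm_rat]), because by the power mean inequality a term at [eps] is
    at most [1 + o(1)] times the term at any slightly smaller [eps']. *)

(** * Power means on a set of finite mass *)

Lemma le_poweR (R : realType) (x y : \bar R) (r : R) :
  0 <= r -> (0 <= x)%E -> (x <= y)%E -> (x `^ r <= y `^ r)%E.
Proof.
move=> r0 x0 xy; apply: gt0_ler_poweR => //.
  by rewrite in_itv/= leey x0.
by rewrite in_itv/= leey (le_trans x0).
Qed.

(** The tangent line at [t] of the concave function [u `^ a], multiplied by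
    [t `^ (1 - a)]; it is also Young's inequality with exponents [a^-1] and
    [(1 - a)^-1]. *)
Lemma young_poweR (R : realType) (u : \bar R) (t a : R) :
  (0 <= u)%E -> 0 < t -> 0 < a -> a < 1 ->
  (u `^ a * (t `^ (1 - a))%:E <= a%:E * u + ((1 - a) * t)%:E)%E.
Proof.
move=> + t0 a0 a1; case: u => [u|_|//]; last first.
  by rewrite gt0_muley ?lte_fin// addye// leey.
rewrite lee_fin => u0; rewrite poweR_EFin -!EFinM -EFinD lee_fin.
have b0 : 0 < 1 - a by rewrite subr_gt0.
have := @conjugate_powR R (u `^ a) (t `^ (1 - a)) a^-1 (1 - a)^-1.
rewrite !powR_ge0 !invr_gt0 a0 b0 !invrK addrC subrK -!powRrM.
rewrite !divff ?gt_eqF// !powRr1 ?(ltW t0)//.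
rewrite [a * _]mulrC [(1 - a) * t]mulrC.
by apply.
Qed.

(** Jensen's inequality for the concave function [u `^ a]: integrate the tangent
    line inequality [young_poweR] and optimise in [t]. Allowing any positive
    upper bound [M] of the mass avoids a separate treatment of null sets. *)
Lemma integral_poweR_le d (T : measurableType d) (R : realType)
    (mu : {measure set T -> \bar R}) (D : set T) (u : T -> \bar R) (M a : R) :
  measurable D -> measurable_fun D u -> (forall x, D x -> 0 <= u x)%E ->
  0 < M -> (mu D <= M%:E)%E -> 0 < a -> a <= 1 ->
  (\int[mu]_(x in D) (u x `^ a) <=
   (\int[mu]_(x in D) u x) `^ a * (M `^ (1 - a))%:E)%E.
Proof.
move=> mD mu_ u0 M0 muD a0; rewrite le_eqVlt => /predU1P[->|a1].
  rewrite subrr powRr0 mule1 poweRe1 ?integral_ge0//.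
  by under eq_integral => x /[!inE] Dx do rewrite poweRe1 ?u0//.
have mua : measurable_fun D (fun x => u x `^ a)%E.
  exact: (measurableT_comp (measurable_poweR a)).
have ua0 x : D x -> (0 <= u x `^ a)%E by move=> _; exact: poweR_ge0.
have b0 : 0 < 1 - a by rewrite subr_gt0.
have I0 : (0 <= \int[mu]_(x in D) u x)%E by exact: integral_ge0.
have young t : 0 < t -> (\int[mu]_(x in D) (u x `^ a) * (t `^ (1 - a))%:E <=
    a%:E * \int[mu]_(x in D) u x + ((1 - a) * t * M)%:E)%E.
  move=> t0; rewrite muleC -ge0_integralZl_EFin ?powR_ge0//.
  apply: (@le_trans _ _ (\int[mu]_(x in D) (a%:E * u x + ((1 - a) * t)%:E))%E).
    apply: ge0_le_integral => //.
    - by move=> x Dx; rewrite mule_ge0 ?lee_fin ?powR_ge0 ?ua0.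
    - exact: measurable_funeM.
    - by apply: emeasurable_funD => //; exact: measurable_funeM.
    - by move=> x Dx; rewrite muleC; apply: young_poweR => //; exact: u0.
  have c0 : 0 <= (1 - a) * t by rewrite mulr_ge0 // ltW.
  rewrite ge0_integralD//=; last 2 first.
  - by move=> x Dx; rewrite mule_ge0 ?lee_fin ?(ltW a0) ?u0.
  - exact: measurable_funeM.
  rewrite ge0_integralZl_EFin ?(ltW a0)// leeD2l//.
  by rewrite integral_cst// [leRHS]EFinM; apply: lee_wpmul2l.
(* When the integral of [u] vanishes the optimal [t] below would be zero. *)
move: I0 young; have [I00 _ _|Ineq0] := eqVneq (\int[mu]_(x in D) u x)%E 0%E.
  have /(ae_eq_integral_abs mu mD mu_) uae0 : (\int[mu]_(x in D) `|u x| = 0)%E.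
    by rewrite -I00; apply: eq_integral => x /[!inE] Dx; rewrite gee0_abs ?u0.
  rewrite (@ae_eq_integral _ _ _ _ _ (cst 0%E))//.
    by rewrite integral_cst// mul0e mule_ge0 ?poweR_ge0// lee_fin powR_ge0.
  by apply: filterS uae0 => x /[apply] /= ->; rewrite poweR0r ?gt_eqF.
case: (\int[mu]_(x in D) u x)%E Ineq0 => [I| |//] Ineq0 I0 young; last first.
  by rewrite poweRyr ?gt_eqF// gt0_mulye ?lte_fin ?powR_gt0// leey.
have {Ineq0} {}I0 : 0 < I.
  by rewrite lt_neqAle eq_sym -lee_fin I0 andbT; apply: contra_neq Ineq0 => ->.
(* Minimising the tangent line bound over [t] gives the mean value [I / M]. *)
have t0 : 0 < I / M by rewrite divr_gt0.
have := young _ t0.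
have -> : (a%:E * I%:E + ((1 - a) * (I / M) * M)%:E = I%:E)%E.
  rewrite -EFinM -EFinD -[(1 - a) * _ * _]mulrA divfK ?gt_eqF//.
  by rewrite -mulrDl addrC subrK mul1r.
have IE : I = I `^ a * M `^ (1 - a) * (I / M) `^ (1 - a).
  rewrite -mulrA -powRM ?(ltW M0) ?(ltW t0)// mulrC [M * _]mulrC divfK ?gt_eqF//.
  by rewrite -powRD ?subrK ?powRr1 ?(ltW I0)// gt_eqF ?oner_neq0.
by rewrite {2}IE EFinM lee_pmul2r ?lte_fin ?powR_gt0//.
Qed.

(** [integral_poweR_le] for the function [`|h| `^ r] and the exponent [s / r]. *)
Lemma Lmean_le d (T : measurableType d) (R : realType)
    (mu : {measure set T -> \bar R}) (D : set T) (h : T -> \bar R) (M s r : R) :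
  measurable D -> measurable_fun D h ->
  0 < M -> (mu D <= M%:E)%E -> 0 < s -> s <= r ->
  ((\int[mu]_(x in D) (`|h x| `^ s)) `^ s^-1 <=
   (\int[mu]_(x in D) (`|h x| `^ r)) `^ r^-1 * (M `^ (s^-1 - r^-1))%:E)%E.
Proof.
move=> mD mh M0 muD s0 sr; have r0 : 0 < r := lt_le_trans s0 sr.
have mhr : measurable_fun D (fun x => `|h x| `^ r)%E.
  by apply: (measurableT_comp (measurable_poweR r)); exact: measurableT_comp.
have := @integral_poweR_le _ _ _ mu D (fun x => `|h x| `^ r)%E M (s / r) mD mhr.
move=> /(_ (fun _ _ => poweR_ge0 _ _) M0 muD).
rewrite divr_gt0// ler_pdivrMr// mul1r sr => /(_ isT isT).
under eq_integral do rewrite -poweRrM mulrC divfK ?gt_eqF//.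
move=> /(@le_poweR _ _ _ s^-1) => /(_ _ _)/le_trans; apply.
- by rewrite invr_ge0 ltW.
- by apply: integral_ge0 => x _; exact: poweR_ge0.
rewrite poweRM ?poweR_ge0 ?lee_fin ?powR_ge0// -poweRrM poweR_EFin -powRrM.
have -> : s / r * s^-1 = r^-1 by rewrite mulrAC divff ?gt_eqF ?mul1r.
by rewrite mulrBl mul1r mulrAC divff ?gt_eqF ?mul1r.
Qed.

(** * Measurability of integrals over translates of a compact set *)

Lemma measurable_fun_countable_sup d (T : measurableType d) (R : realType)
    (I : countType) (P : set I) (D : set T) (F : I -> T -> \bar R) :
  (forall i, P i -> measurable_fun D (F i)) ->
  measurable_fun D (fun x => ereal_sup [set F i x | i in P]).
Proof.
move=> mF.
pose f n x := if @unpickle I n is Some i then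
                if i \in P then F i x else -oo%E else -oo%E.
rewrite (_ : (fun x => _) = (fun x => esups (f ^~ x) 0)).
  apply: measurable_fun_esups => n; rewrite /f.
  case: (@unpickle I n) => [i|]; last exact: measurable_cst.
  by case: (boolP (i \in P)) => [/set_mem|_]; [exact: mF|exact: measurable_cst].
apply/funext => x; rewrite /esups /sdrop; apply/eqP; rewrite eq_le.
apply/andP; split; apply: ge_ereal_sup => y /=.
  move=> [i Pi <-]; apply: ereal_sup_ubound; exists (pickle i) => //=.
  by rewrite /f pickleK mem_set.
move=> [n _ <-]; rewrite /f; case: (@unpickle I n) => [i|]; last exact: leNye.
by case: ifPn => [/set_mem Pi|_]; [apply: ereal_sup_ubound; exists i|exact: leNye].
Qed.

Lemma measurable_fun_open_lt (R : realType) (G : topologicalZmodType)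
    (f : borel G -> \bar R) :
  (forall a, open ([set x | f x < a%:E]%E : set G)) -> measurable_fun setT f.
Proof.
move=> fo; apply: (measurability _ (ErealGenInftyO.measurableE R)).
move=> _ [_ [a ->] <-]; rewrite setTI; apply: sub_sigma_algebra.
by have := fo a; congr (open _).
Qed.

Lemma open_of_nbhs (T : topologicalType) (A : set T) :
  (forall x, A x -> nbhs x A) -> open A.
Proof. by rewrite openE. Qed.

(** The complement is the difference set [K - Q], which is compact as a
    continuous image of a product of compact sets. *)
Lemma open_disjoint_translate (G : topologicalZmodType) (Q K : set (borel G)) :
  hausdorff_space G -> compact (Q : set G) -> compact (K : set G) ->
  open ([set x | K `&` translate Q x `<=` set0] : set G).
Proof.
move=> hG cQ cK; rewrite -[X in open X]setCK openC.
rewrite (_ : ~` _ = (fun z : G * G => z.1 - z.2) @` ((K : set G) `*` (Q : set G))).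
  apply: compact_closed => //; apply: continuous_compact; last exact: compact_setX.
  exact/continuous_subspaceT/sub_continuous.
apply/seteqP; split=> x /=.
  move=> /existsNP[k /not_implyP[[Kk [t Qt tx]] _]].
  by exists (k, t) => //=; rewrite -tx addrAC subrr add0r.
by move=> [[k t] /= [Kk Qt] <-] /(_ k); apply; split=> //; exists t; rewrite // addrC subrK.
Qed.

Section translates.
Context {R : realType} {G : topologicalZmodType}.
Variables (hausG : hausdorff_space G).
Variables (mu : {measure set (borel G) -> \bar R}) (Omega Q : set (borel G)).
Hypotheses (mOmega : measurable Omega) (finmu : (mu Omega < +oo)%E).
Hypotheses (regmu : regular_on mu Omega) (cQ : compact (Q : set G)).

Lemma compact_measurable (K : set (borel G)) : compact (K : set G) -> measurable K.
Proof.
move=> cK; rewrite -[K]setCK; apply: measurableC; apply: sub_sigma_algebra.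
by apply: closed_openC; exact: compact_closed.
Qed.

Lemma compact_translate x : compact (translate Q x : set G).
Proof.
apply: (@continuous_compact G G (fun t => t + x)) => //.
apply: continuous_subspaceT => t.
apply: (@continuous_comp _ _ _ (fun t => (t, x)) (fun z : G * G => z.1 + z.2)).
  by apply: cvg_pair; [exact: cvg_id|exact: cvg_cst].
exact: add_continuous.
Qed.

Lemma measurable_translate x : measurable (translate Q x).
Proof. by apply: compact_measurable; exact: compact_translate. Qed.

(** Upper semicontinuity at [x0]: by regularity there is a compact subset [K] of
    [A `\` translate Q x0] with [mu (A `\` K) < a] as soon as
    [mu (A `&` translate Q x0) < a]. For [x] near [x0] the set [translate Q x]
    still misses [K], so [A `&` translate Q x] lies in [A `\` K]. *)
Lemma measurable_fun_mu_translate (A : set (borel G)) :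
  measurable A -> A `<=` Omega ->
  measurable_fun setT (fun x : borel G => mu (A `&` translate Q x)).
Proof.
move=> mA AO; apply: measurable_fun_open_lt => a.
have finA B : measurable B -> B `<=` A -> mu B \is a fin_num.
  move=> mB BA; rewrite ge0_fin_numE ?measure_ge0//.
  apply: le_lt_trans finmu; apply: le_measure; rewrite ?inE//.
  exact: subset_trans BA AO.
apply: open_of_nbhs => x0 /= mua.
have mQ := measurable_translate.
have mAQ : measurable (A `\` translate Q x0) by exact: measurableD.
have finAQ : mu (A `&` translate Q x0) \is a fin_num.
  by apply: finA; [exact: measurableI|exact: subIsetl].
have : (mu A - a%:E < mu (A `\` translate Q x0))%E.
  have -> : (mu (A `\` translate Q x0) = mu A - mu (A `&` translate Q x0))%E.
    by rewrite measureD// ltey_eq finA.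
  rewrite -(fineK (finA _ mA _))// -(fineK finAQ) -!EFinB lte_fin ltrD2l ltrN2.
  by rewrite -lte_fin fineK.
rewrite (regmu mAQ); last by move=> x [/AO].
move=> /ereal_sup_gt[_ [K [cK KA] <-]] Kgt.
have mK := compact_measurable cK.
have dK : K `&` translate Q x0 `<=` set0 by move=> z [/KA[]].
have := open_nbhs_nbhs (conj (open_disjoint_translate hausG cQ cK) dK).
apply: filterS => x /= KQ.
have KA' : K `<=` A by move=> z /KA[].
apply: (@le_lt_trans _ _ (mu (A `\` K))).
  apply: le_measure; rewrite ?inE//; [exact: measurableI|exact: measurableD|].
  by move=> z [Az Qz]; split=> // Kz; exact: (KQ z).
have -> : (mu (A `\` K) = mu A - mu K)%E.
  by rewrite measureD// ?(setIidr KA')// ltey_eq finA.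
move: Kgt.
rewrite -(fineK (finA _ mA _))// -(fineK (finA _ mK _))//.
by rewrite -!EFinB !lte_fin ltrBlDr ltrBlDr addrC.
Qed.

Lemma integral_mrestr (D : set (borel G)) (mD : measurable D)
    (g : borel G -> \bar R) :
  measurable_fun setT g -> (forall x, 0 <= g x)%E ->
  (\int[mrestr mu mD]_x g x = \int[mu]_(x in D) g x)%E.
Proof.
move=> mg g0; rewrite (@ge0_negligible_integral _ _ _ _ setT (~` D))//.
- rewrite setTD setCK; apply: eq_measure_integral => A mA AD /=.
  by rewrite /mrestr setIidl.
- exact: measurableC.
- by rewrite /= /mrestr setICl measure0.
Qed.

(** The restrictions of [mu] to [Omega `&` translate Q x] form a kernel in [x],
    by [measurable_fun_mu_translate], and integration against a kernel preserves
    measurability. *)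
Lemma measurable_fun_integral_translate (g : borel G -> \bar R) :
  measurable_fun Omega g -> (forall x, 0 <= g x)%E ->
  measurable_fun setT
    (fun x : borel G => \int[mu]_(y in Omega `&` translate Q x) g y)%E.
Proof.
move=> mg g0.
have mOQ x : measurable (Omega `&` translate Q x).
  by apply: measurableI => //; exact: measurable_translate.
have mgO : measurable_fun setT (g \_ Omega).
  by apply/(measurable_restrictT _ _).1.
have gO0 x : (0 <= (g \_ Omega) x)%E by exact: erestrict_ge0.
rewrite (_ : (fun x => _) = (fun x => \int[mrestr mu (mOQ x)]_y (g \_ Omega) y)%E).
  apply: measurable_fun_integral_kernel => // U mU.
  rewrite (_ : (fun x => _) = (fun x => mu ((U `&` Omega) `&` translate Q x))).
    by apply: measurable_fun_mu_translate; [exact: measurableI|exact: subIsetr].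
  by apply/funext => x; rewrite /= /mrestr setIA.
apply/funext => x; rewrite integral_mrestr//.
by apply: eq_integral => y /[!inE] -[Oy _]; rewrite patchE mem_set.
Qed.

End translates.

(** * Comparison of grand norms *)

Section grand_norm_theory.
Context {R : realType} {G : topologicalZmodType}.
Variables (mu : {measure set (borel G) -> \bar R}) (Omega : set (borel G)).
Hypotheses (mOmega : measurable Omega).
Variable theta : R.

Lemma le_mass_bound : (mu Omega < +oo)%E ->
  (mu Omega <= (Num.max 1 (fine (mu Omega)))%:E)%E.
Proof.
by move=> ?; rewrite -[leLHS]fineK ?ge0_fin_numE// lee_fin le_max lexx orbT.
Qed.

(** The expression whose supremum over [eps] is [grand_norm]. *)
Definition grand_term (p : R) (h : borel G -> \bar R) (eps : R) : \bar R :=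
  ((eps `^ (theta / (p - eps)))%:E *
   (\int[mu]_(x in Omega) `|h x| `^ (p - eps)) `^ (p - eps)^-1)%E.

Lemma grand_term_ge0 p h e : (0 <= grand_term p h e)%E.
Proof. by rewrite mule_ge0 ?poweR_ge0// lee_fin powR_ge0. Qed.

Lemma grand_term_le_grand_norm p h e : 0 < e <= p - 1 ->
  (grand_term p h e <= grand_norm mu Omega theta p h)%E.
Proof. by move=> ep; apply: ereal_sup_ubound; exists e. Qed.

Lemma grand_norm_ge0 p h : 1 < p -> (0 <= grand_norm mu Omega theta p h)%E.
Proof.
move=> p1; apply: (le_trans (grand_term_ge0 p h (p - 1))).
by apply: grand_term_le_grand_norm; rewrite subr_gt0 p1 lexx.
Qed.

Lemma le_grand_norm p (f g : borel G -> \bar R) (C : R) : 1 < p ->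
  measurable_fun Omega f -> measurable_fun Omega g -> 0 <= C ->
  (forall x, Omega x -> `|f x| <= C%:E * `|g x|)%E ->
  (grand_norm mu Omega theta p f <= C%:E * grand_norm mu Omega theta p g)%E.
Proof.
move=> p1 mf mg C0 fg; apply: ge_ereal_sup => _ [e /= ep <-].
apply: (@le_trans _ _ (C%:E * grand_term p g e)%E); last first.
  by apply: lee_wpmul2l; [rewrite lee_fin|exact: grand_term_le_grand_norm].
rewrite /grand_term muleCA lee_wpmul2l ?lee_fin ?powR_ge0//.
have s0 : 0 < p - e by case/andP: ep => e0 e1; lra.
have mp h : measurable_fun Omega h ->
    measurable_fun Omega (fun x => `|h x| `^ (p - e))%E.
  by move=> mh; apply: (measurableT_comp (measurable_poweR _)); exact: measurableT_comp.
have -> : (C%:E = (C%:E `^ (p - e)) `^ (p - e)^-1)%E.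
  by rewrite -poweRrM divff ?gt_eqF// poweRe1.
have I0 h : (0 <= \int[mu]_(x in Omega) `|h x| `^ (p - e))%E.
  by apply: integral_ge0 => x _; exact: poweR_ge0.
rewrite -poweRM ?poweR_ge0//; apply: le_poweR => //; first by rewrite invr_ge0 ltW.
rewrite -ge0_integralZl//; [|exact: mp|by move=> *; exact: poweR_ge0|exact: poweR_ge0].
apply: ge0_le_integral => //; [by move=> *; exact: poweR_ge0|exact: mp| |].
  by apply: measurable_funeM; exact: mp.
move=> x Ox; rewrite -poweRM//; apply: le_poweR => //; first exact: ltW.
exact: fg.
Qed.

(** The factor on the right is the ratio of the two weights times the constant of
    [Lmean_le]; it tends to [1] as [e'] tends to [e], by [cvg_ratio]. *)
Lemma grand_term_le_exponent (M p : R) (h : borel G -> \bar R) e e' :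
  0 < M -> (mu Omega <= M%:E)%E -> measurable_fun Omega h ->
  0 < e' -> e' <= e -> e < p ->
  (grand_term p h e <= (e `^ (theta / (p - e)) / e' `^ (theta / (p - e')) *
     M `^ ((p - e)^-1 - (p - e')^-1))%:E * grand_term p h e')%E.
Proof.
move=> M0 muM mh e'0 e'e ep; rewrite /grand_term.
rewrite muleA -EFinM mulrAC divfK ?gt_eqF ?powR_gt0// EFinM -muleA.
rewrite lee_wpmul2l ?lee_fin ?powR_ge0// muleC.
by apply: Lmean_le => //; [rewrite subr_gt0|rewrite lerD2l lerN2].
Qed.

Lemma cvg_ratio (M p e : R) : 0 < M -> 0 < e -> e < p ->
  (e `^ (theta / (p - e)) / e' `^ (theta / (p - e')) *
     M `^ ((p - e)^-1 - (p - e')^-1)) @[e' --> e] --> (1 : R).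
Proof.
move=> M0 e0 ep.
have s0 : p - e != 0 by rewrite gt_eqF// subr_gt0.
have cV : (p - x)^-1 @[x --> e] --> (p - e)^-1.
  by apply: cvgV => //; apply: cvgB; [exact: cvg_cst|exact: cvg_id].
pose l x : R := theta * (p - e)^-1 * ln e - theta * (p - x)^-1 * ln x +
   ((p - e)^-1 - (p - x)^-1) * ln M.
have le0 : l e = 0 by rewrite /l !subrr mul0r addr0.
have cl : l x @[x --> e] --> l e.
  apply: cvgD.
    apply: cvgB; first exact: cvg_cst.
    apply: cvgM; last exact: continuous_ln.
    by apply: cvgM => //; exact: cvg_cst.
  apply: cvgM; last exact: cvg_cst.
  by apply: cvgB => //; exact: cvg_cst.
have cg : expR (l x) @[x --> e] --> (1 : R).
  rewrite -[X in _ --> X]expR0 -le0.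
  by apply: continuous_cvg => //; exact: continuous_expR.
apply: cvg_trans cg; apply: near_eq_cvg; near=> x.
have x0 : 0 < x by near: x; exact: lt_nbhsr.
rewrite /l /powR !gt_eqF// expRD expRB; congr (_ / _ * _).
Unshelve. all: by end_near. Qed.

Definition rat_domain (p : R) : set rat := [set q | 0 < (ratr q : R) <= p - 1].

(** Approach [e] from the left by rationals [q]: the term at [e] is at most
    [l] times the term at [q] for any [l > 1], once [q] is close to [e]. Only
    smaller [q] are usable, since the power mean inequality bounds an exponent
    [p - e] by larger exponents. *)
Lemma grand_norm_rat p (h : borel G -> \bar R) :
  (mu Omega < +oo)%E -> measurable_fun Omega h ->
  grand_norm mu Omega theta p h =
  ereal_sup [set grand_term p h (ratr q) | q in rat_domain p].
Proof.
move=> finmu mh; have muM := le_mass_bound finmu; set M := Num.max _ _ in muM.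
have M0 : 0 < M by rewrite lt_max ltr01.
apply/eqP; rewrite eq_le; apply/andP; split; last first.
  by apply: ge_ereal_sup => _ [q qp <-]; exact: grand_term_le_grand_norm.
apply: ge_ereal_sup => _ [e /= /andP[e0 ep] <-]; rewrite -/(grand_term p h e).
set S := ereal_sup _.
have ep1 : e < p by lra.
have key l : 1 < l -> (grand_term p h e <= l%:E * S)%E /\ (0 <= S)%E.
  move=> l1; have := cvg_ratio M0 e0 ep1; move=> /cvgr_lt/(_ _ l1)/nbhs_ballP.
  move=> [d /= d0 dl].
  have /rat_in_itvoo[q] : Num.max 0 (e - d) < e by rewrite gt_max e0 ltrBlDr ltrDl.
  rewrite in_itv /= gt_max => /andP[/andP[q0 edq] qe].
  have /dl {}dl : ball e d (ratr q) by rewrite /ball /= gtr0_norm; lra.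
  have qS : (grand_term p h (ratr q) <= S)%E.
    by apply: ereal_sup_ubound; exists q => //; rewrite /rat_domain /=; lra.
  split; last exact: le_trans (grand_term_ge0 p h (ratr q)) qS.
  apply: (le_trans (grand_term_le_exponent M0 muM mh q0 (ltW qe) ep1)).
  apply: lee_pmul => //; last by rewrite lee_fin ltW.
    by rewrite lee_fin mulr_ge0 ?divr_ge0 ?powR_ge0.
  exact: grand_term_ge0.
have S0 : (0 <= S)%E by have [] := key 2 (ltr1n R 2).
move: S0 key; case: S => [S| |//] S0 key; last exact: leey.
rewrite lee_fin in S0; apply/lee_addgt0Pr => eta eta0.
(* With [l = 1 + eta / (S + 1)] one gets [l * S <= S + eta]. *)
have S10 : 0 < S + 1 by lra.
have l1 : 1 < 1 + eta / (S + 1) by rewrite ltrDl divr_gt0.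
apply: (le_trans (key _ l1).1); rewrite -EFinM -EFinD lee_fin mulrDl mul1r lerD2l.
by rewrite mulrAC ler_pdivrMr// ler_pM2l//; lra.
Qed.

(** The exponent on the left exceeds the one on the right by at most [theta],
    because [p2 - e] is at least [1]. So for [e > 1] the ratio of the two powers
    of [e] is at most [e `^ theta], while for [e <= 1] the larger exponent gives
    the smaller power. *)
Lemma grand_weight_le p1 p2 e :
  0 <= theta -> 1 < p2 -> p2 <= p1 -> 0 < e -> e <= p2 - 1 ->
  e `^ (theta / (p2 - e)) <= p2 `^ theta * e `^ (theta / (p1 - e)).
Proof.
move=> theta0 p21 p2p1 e0 ep.
have ba : theta / (p1 - e) <= theta / (p2 - e).
  by rewrite ler_wpM2l// lef_pV2 ?posrE; lra.
have at_ : theta / (p2 - e) <= theta by rewrite ler_pdivrMr ?ler_peMr//; lra.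
have b0 : 0 <= theta / (p1 - e) by rewrite divr_ge0//; lra.
have [e1|e1] := leP e 1.
  apply: (@le_trans _ _ (e `^ (theta / (p1 - e)))).
    by apply: ger_powR => //; rewrite e0 e1.
  by rewrite ler_peMl ?powR_ge0// -(powRr0 p2) ler_powR// ltW.
rewrite -{1}(subrK (theta / (p1 - e)) (theta / (p2 - e))) powRD; last first.
  by rewrite (gt_eqF e0) implybT.
rewrite ler_wpM2r ?powR_ge0//.
apply: (@le_trans _ _ (e `^ theta)); first by apply: ler_powR; lra.
by apply: ge0_ler_powR => //; rewrite ?nnegrE; lra.
Qed.

(** Compare the terms with the same [eps], which is in the range of both suprema.
    Since [p2 - eps] is at least [1], the power of the mass in [Lmean_le] has an
    exponent in the unit interval, whence the bound by [Num.max 1 _]. *)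
Lemma grand_norm_le_exponent p1 p2 (h : borel G -> \bar R) :
  (mu Omega < +oo)%E -> 0 <= theta -> 1 < p2 -> p2 <= p1 ->
  measurable_fun Omega h ->
  (grand_norm mu Omega theta p2 h <=
   (p2 `^ theta * Num.max 1 (fine (mu Omega)))%:E *
     grand_norm mu Omega theta p1 h)%E.
Proof.
move=> finmu theta0 p21 p2p1 mh.
have muM := le_mass_bound finmu; set M := Num.max _ _ in muM *.
have M1 : 1 <= M by rewrite le_max lexx.
have M0 : 0 < M := lt_le_trans ltr01 M1.
apply: ge_ereal_sup => _ [e /= /andP[e0 ep] <-].
have C0 : 0 <= p2 `^ theta * M by rewrite mulr_ge0 ?powR_ge0// ltW.
apply: (@le_trans _ _ ((p2 `^ theta * M)%:E * grand_term p1 h e)%E); last first.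
  apply: lee_wpmul2l; first by rewrite lee_fin.
  by apply: grand_term_le_grand_norm; lra.
have s1 : 1 <= p2 - e by lra.
have sr : p2 - e <= p1 - e by lra.
have s0 : 0 < p2 - e by lra.
have := Lmean_le mOmega mh M0 muM s0 sr => /le_trans; move=> Lm.
rewrite /grand_term.
set N := ((\int[mu]_(x in Omega) _) `^ (p1 - e)^-1)%E in Lm *.
have N0 : (0 <= N)%E by exact: poweR_ge0.
apply: (@le_trans _ _ ((p2 `^ theta * e `^ (theta / (p1 - e)))%:E * (N * M%:E))%E).
  apply: lee_pmul; rewrite ?lee_fin ?powR_ge0 ?poweR_ge0//.
    exact: grand_weight_le.
  apply: Lm; apply: lee_wpmul2l => //; rewrite lee_fin -[leRHS]powRr1 ?(ltW M0)//.
    apply: ler_powR => //; apply: (@le_trans _ _ (p2 - e)^-1).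
    by rewrite gerBl invr_ge0; lra.
  by rewrite invf_le1.
by rewrite !EFinM -!muleA lee_wpmul2l ?lee_fin ?powR_ge0// [leRHS]muleCA (muleC N).
Qed.

End grand_norm_theory.

(** * The control function and the inclusion of amalgam spaces *)

Section control_function.
Context {R : realType} {G : topologicalZmodType}.
Variables (hausG : hausdorff_space G).
Variables (mu : {measure set (borel G) -> \bar R}) (Omega Q : set (borel G)).
Hypotheses (mOmega : measurable Omega) (finmu : (mu Omega < +oo)%E).
Hypotheses (regmu : regular_on mu Omega) (cQ : compact (Q : set G)).
Variable theta : R.

Lemma measurable_fun_restrict_translate (f : borel G -> \bar R) (x : G) :
  measurable_fun Omega f -> measurable_fun Omega (f \_ (translate Q x)).
Proof.
move=> mf; apply/measurable_restrict => //; first exact: measurable_translate.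
exact: measurable_funS mf.
Qed.

Lemma measurable_fun_control p (f : borel G -> \bar R) :
  measurable_fun Omega f -> measurable_fun setT (control_fun mu Omega theta Q p f).
Proof.
move=> mf.
rewrite (_ : control_fun _ _ _ _ _ _ = (fun x => ereal_sup
    [set grand_term mu Omega theta p (f \_ (translate Q x)) (ratr q)
      | q in rat_domain p])).
  apply: measurable_fun_countable_sup => q /andP[q0 qp].
  apply: measurable_funeM; apply: (measurableT_comp (measurable_poweR _)).
  rewrite [X in measurable_fun _ X](_ : _ = (fun x : borel G =>
      \int[mu]_(y in Omega `&` translate Q x) (`|f y| `^ (p - ratr q)))%E).
    have mfs : measurable_fun Omega (fun y => `|f y| `^ (p - ratr q))%E.
      by apply: (measurableT_comp (measurable_poweR _)); exact: measurableT_comp.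
    exact: (measurable_fun_integral_translate hausG mOmega finmu regmu cQ mfs
      (fun _ => poweR_ge0 _ _)).
  apply/funext => x; rewrite integral_mkcondr; apply: eq_integral => y _.
  rewrite !patchE; case: ifPn => // _; rewrite abse0 poweR0r//.
  by rewrite gt_eqF//; lra.
apply/funext => x; rewrite /control_fun (grand_norm_rat mOmega)//.
exact: measurable_fun_restrict_translate.
Qed.

End control_function.

Theorem corollary1 (R : realType) (G : topologicalZmodType)
  (hausG : hausdorff_space G) (lcG : locally_compact [set: G])
  (Omega : set (borel G)) (mOmega : measurable Omega)
  (lcOmega : @locally_compact (subspace (Omega : set G)) Omega)
  (mu : {measure set (borel G) -> \bar R}) (finmu : (mu Omega < +oo)%E)
  (regmu : regular_on mu Omega)
  (Q : set (borel G)) (cQ : compact (Q : set G)) (QOmega : Q `<=` Omega)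
  (intQ : (Q : set (subspace (Omega : set G)))° !=set0)
  (theta p1 p2 q1 q2 : R) (theta0 : 0 <= theta)
  (p2gt1 : 1 < p2) (p21 : p2 <= p1) (q2gt1 : 1 < q2) (q21 : q2 <= q1) :
  grand_amalgam mu Omega theta Q p1 q1 `<=` grand_amalgam mu Omega theta Q p2 q2.
Proof.
have C0 p : 0 <= p `^ theta * Num.max 1 (fine (mu Omega)).
  by rewrite mulr_ge0 ?powR_ge0// (le_trans ler01)// le_max lexx.
move=> f [[mf floc] [mc1 c1fin]]; split.
  split; first exact: mf.
  move=> K cK KO; have [mfK fKfin] := floc K cK KO; split; first exact: mfK.
  apply: (le_lt_trans (grand_norm_le_exponent mOmega finmu theta0 p2gt1 p21 mfK)).
  by apply: lte_mul_pinfty fKfin; [exact: C0|].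
have mc2 : measurable_fun Omega (control_fun mu Omega theta Q p2 f).
  by apply: measurable_funTS; exact: measurable_fun_control.
split; first exact: mc2.
have q1gt1 := lt_le_trans q2gt1 q21; have p1gt1 := lt_le_trans p2gt1 p21.
have c2c1 x : Omega x -> (`|control_fun mu Omega theta Q p2 f x| <=
    (p2 `^ theta * Num.max 1 (fine (mu Omega)))%:E *
    `|control_fun mu Omega theta Q p1 f x|)%E.
  move=> _; rewrite gee0_abs ?grand_norm_ge0// gee0_abs ?grand_norm_ge0//.
  apply: grand_norm_le_exponent => //.
  exact: measurable_fun_restrict_translate.
have c2fin :
    (grand_norm mu Omega theta q1 (control_fun mu Omega theta Q p2 f) < +oo)%E.
  apply: (le_lt_trans (le_grand_norm mu mOmega theta q1gt1 mc2 mc1 (C0 p2) c2c1)).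
  by apply: lte_mul_pinfty c1fin; [exact: C0|].
apply: (le_lt_trans (grand_norm_le_exponent mOmega finmu theta0 q2gt1 q21 mc2)).
by apply: lte_mul_pinfty c2fin; [exact: C0|].
Qed.
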